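(* Let $k\ge1$. For $n\ge1$ let $p_n=x_1^n+x_3^n+\cdots+x_{2k-1}^n-(x_2^n+x_4^n+\cdots+x_{2k}^n)\in\mathcal{A}_{2k}^{\mathrm{aff}}$, and let $\mathsf{SSym}[x_1,\dots,x_{2k}]$ be the subalgebra of $\mathcal{A}_{2k}^{\mathrm{aff}}$ generated by all $p_n$, $n\ge1$. Then $\mathsf{SSym}[x_1,\dots,x_{2k}]$ is contained in the centre $Z(\mathcal{A}_{2k}^{\mathrm{aff}})$.
   Context: **Affine partition algebra.** Fix $k\ge1$; $[m]=\{1,\dots,m\}$. $\mathcal{A}_{2k}^{\mathrm{aff}}$ is the unital associative $\mathbb{C}$-algebra with generators $\tau_i$ ($2\le i\le 2k-1$), $e_j$ ($1\le j\le 2k-1$), $x_r$ ($1\le r\le 2k$), $z_l$ ($l\in\mathbb{Z}_{\ge0}$) and the following relations (where no range is given, for all indices for which all generators involved are defined): (1) $\tau_{2i}^2=1-e_{2i}$, $\tau_{2i+1}^2=1-e_{2i}$ for $i\in[k-1]$. (2) $\tau_{2i+1}\tau_{2j}=\tau_{2j}\tau_{2i+1}$ for $j\ne i+1$; $\tau_{2i+1}\tau_{2j+1}=\tau_{2j+1}\tau_{2i+1}$ and $\tau_{2i}\tau_{2j}=\tau_{2j}\tau_{2i}$ for $j\ne i\pm1$; $s_is_{i+1}s_i=s_{i+1}s_is_{i+1}$ for $i\in[k-2]$, where $s_j:=\tau_{2j}\tau_{2j+1}+e_{2j}$. (3) $e_{2i-1}^2=z_0e_{2i-1}$ ($i\in[k]$);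 and for $i\in[k-1]$: $e_{2i}^2=e_{2i}$, $\tau_{2i+1}e_{2i}=e_{2i}\tau_{2i+1}=0$, $\tau_{2i}e_{2i}=e_{2i}\tau_{2i}=0$, $\tau_{2i}e_{2i-1}e_{2i+1}=\tau_{2i+1}e_{2i-1}e_{2i+1}$, $e_{2i+1}e_{2i-1}\tau_{2i}=e_{2i+1}e_{2i-1}\tau_{2i+1}$. (4) $e_ie_j=e_je_i$ if $|i-j|\ge2$; $\tau_{2i-1}e_{2j-1}=e_{2j-1}\tau_{2i-1}$ if $j\ne i-1,i$; $\tau_{2i-1}e_{2j}=e_{2j}\tau_{2i-1}$ if $j\ne i$; $\tau_{2i}e_{2j-1}=e_{2j-1}\tau_{2i}$ if $j\neq i,i+1$; $\tau_{2i}e_{2j}=e_{2j}\tau_{2i}$ if $j\ne i-1$. (5) $e_ie_{i+1}e_i=e_i$, $e_{i+1}e_ie_{i+1}=e_{i+1}$ for $i\in[2k-2]$; $\tau_{2i}e_{2i-1}\tau_{2i}=\tau_{2i+1}e_{2i+1}\tau_{2i+1}$ for $i\in[k-1]$; $\tau_{2i}e_{2i-2}\tau_{2i}=\tau_{2i-1}e_{2i}\tau_{2i-1}$ for $2\le i\le k-1$. (6) $x_ix_j=x_jx_i$; $\tau_ix_j=x_j\tau_i$ for $j\ne i-1,i,i+1$; $e_ix_j=x_je_i$ for $j\ne i,i+1$. (7) $\tau_{2i-2}\tau_{2i}\tau_{2i-2}=\tau_{2i}\tau_{2i-2}\tau_{2i}(1-e_{2i-2})$; $\tau_{2i+1}\tau_{2i-1}\tau_{2i+1}=\tau_{2i-1}\tau_{2i+1}\tau_{2i-1}(1-e_{2i})$;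 $\tau_{2i-1}\tau_{2i}\tau_{2i-1}=\tau_{2i}-e_{2i-2}\tau_{2i}-\tau_{2i}e_{2i-2}$; $\tau_{2i}\tau_{2i-1}\tau_{2i}=\tau_{2i-1}-e_{2i}\tau_{2i-1}-\tau_{2i-1}e_{2i}$. (8) $x_{2i+1}=\tau_{2i}x_{2i-1}\tau_{2i}+e_{2i}e_{2i-1}\tau_{2i}+\tau_{2i}e_{2i-1}e_{2i}-\tau_{2i}$; $x_{2i+2}=\tau_{2i+1}x_{2i}\tau_{2i+1}+e_{2i}e_{2i+1}\tau_{2i+1}e_{2i+1}e_{2i}+\tau_{2i+1}$; $x_{2i}=\tau_{2i}x_{2i}\tau_{2i}+e_{2i}e_{2i-1}\tau_{2i}+\tau_{2i}e_{2i-1}e_{2i}$; $x_{2i+1}=\tau_{2i+1}x_{2i+1}\tau_{2i+1}+e_{2i}e_{2i+1}\tau_{2i+1}+\tau_{2i+1}e_{2i+1}e_{2i}$. (9) $e_i(x_i-x_{i+1})=0=(x_i-x_{i+1})e_i$ for $i\in[2k-1]$. (10) $e_1x_1^le_1=z_le_1$ for $l\ge1$; every $z_l$ ($l\ge0$) is central. *)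

(* Defs.v *)
From HB Require Import structures.
From mathcomp Require Import all_boot all_order all_algebra.
From mathcomp Require Import generic_quotient ring_quotient.
From mathcomp Require Import boolp classical_sets reals complex.
From mathcomp Require Import zify.
From mathcomp.multinomials Require Import monalg.

Set Implicit Arguments.
Unset Strict Implicit.
Unset Printing Implicit Defensive.

Import GRing.Theory.
Local Open Scope ring_scope.
Local Open Scope classical_set_scope.
Local Open Scope quotient_scope.

Definition two_sided_ideal (A : nzRingType) (I : set A) : Prop :=
  GRing.zmod_closed (mem I) /\ forall a u b : A, I u -> I (a * u * b).

Definition ideal_generated (A : nzRingType) (G : set A) : set A :=
  smallest (@two_sided_ideal A) G.

(* Algebras and their subalgebras are unital. *)
Definition subalg_generated (K : pzRingType) (A : lalgType K) (G : set A)
    : set A :=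
  smallest (fun S : set A => GRing.subalg_closed (mem S)) G.

Definition alg_center (A : nzRingType) : set A :=
  [set a | forall b : A, GRing.comm a b].

Section Relations.
Variable k : nat.

Definition tau_dom (i : nat) : bool := (2 <= i <= k.*2.-1)%N.
Definition e_dom (j : nat) : bool := (1 <= j <= k.*2.-1)%N.
Definition x_dom (r : nat) : bool := (1 <= r <= k.*2)%N.

Variables (A : nzRingType) (tau e x z : nat -> A).

Definition sgen (j : nat) : A := tau j.*2 * tau j.*2.+1 + e j.*2.

(* Truncated predecessors are harmless: whenever a subtraction is truncated the
   resulting index is 0, which is in none of the three domains. *)
Inductive aff_rel : A -> A -> Prop :=
| rel_tau_even_sq i : (1 <= i <= k.-1)%N ->
    aff_rel (tau i.*2 ^+ 2) (1 - e i.*2)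
| rel_tau_odd_sq i : (1 <= i <= k.-1)%N ->
    aff_rel (tau i.*2.+1 ^+ 2) (1 - e i.*2)

| rel_tau_oddC_even i j : tau_dom i.*2.+1 -> tau_dom j.*2 -> j != i.+1 ->
    aff_rel (tau i.*2.+1 * tau j.*2) (tau j.*2 * tau i.*2.+1)
| rel_tau_oddC_odd i j : tau_dom i.*2.+1 -> tau_dom j.*2.+1 ->
    j != i.+1 -> j.+1 != i ->
    aff_rel (tau i.*2.+1 * tau j.*2.+1) (tau j.*2.+1 * tau i.*2.+1)
| rel_tau_evenC_even i j : tau_dom i.*2 -> tau_dom j.*2 ->
    j != i.+1 -> j.+1 != i ->
    aff_rel (tau i.*2 * tau j.*2) (tau j.*2 * tau i.*2)
| rel_s_braid i : (1 <= i <= k.-2)%N ->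
    aff_rel (sgen i * sgen i.+1 * sgen i) (sgen i.+1 * sgen i * sgen i.+1)

| rel_e_odd_sq i : (1 <= i <= k)%N ->
    aff_rel (e i.*2.-1 ^+ 2) (z 0 * e i.*2.-1)
| rel_e_even_sq i : (1 <= i <= k.-1)%N ->
    aff_rel (e i.*2 ^+ 2) (e i.*2)
| rel_tau_odd_e i : (1 <= i <= k.-1)%N ->
    aff_rel (tau i.*2.+1 * e i.*2) 0
| rel_e_tau_odd i : (1 <= i <= k.-1)%N ->
    aff_rel (e i.*2 * tau i.*2.+1) 0
| rel_tau_even_e i : (1 <= i <= k.-1)%N ->
    aff_rel (tau i.*2 * e i.*2) 0
| rel_e_tau_even i : (1 <= i <= k.-1)%N ->
    aff_rel (e i.*2 * tau i.*2) 0
| rel_tau_e_e i : (1 <= i <= k.-1)%N ->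
    aff_rel (tau i.*2 * e i.*2.-1 * e i.*2.+1)
            (tau i.*2.+1 * e i.*2.-1 * e i.*2.+1)
| rel_e_e_tau i : (1 <= i <= k.-1)%N ->
    aff_rel (e i.*2.+1 * e i.*2.-1 * tau i.*2)
            (e i.*2.+1 * e i.*2.-1 * tau i.*2.+1)

| rel_eC i j : e_dom i -> e_dom j -> (2 <= `|i%:Z - j%:Z|)%N ->
    aff_rel (e i * e j) (e j * e i)
| rel_tau_oddC_e_odd i j : tau_dom i.*2.-1 -> e_dom j.*2.-1 ->
    j.+1 != i -> j != i ->
    aff_rel (tau i.*2.-1 * e j.*2.-1) (e j.*2.-1 * tau i.*2.-1)
| rel_tau_oddC_e_even i j : tau_dom i.*2.-1 -> e_dom j.*2 -> j != i ->
    aff_rel (tau i.*2.-1 * e j.*2) (e j.*2 * tau i.*2.-1)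
| rel_tau_evenC_e_odd i j : tau_dom i.*2 -> e_dom j.*2.-1 ->
    j != i -> j != i.+1 ->
    aff_rel (tau i.*2 * e j.*2.-1) (e j.*2.-1 * tau i.*2)
| rel_tau_evenC_e_even i j : tau_dom i.*2 -> e_dom j.*2 -> j.+1 != i ->
    aff_rel (tau i.*2 * e j.*2) (e j.*2 * tau i.*2)

| rel_e_eS_e i : (1 <= i <= k.*2.-2)%N ->
    aff_rel (e i * e i.+1 * e i) (e i)
| rel_eS_e_eS i : (1 <= i <= k.*2.-2)%N ->
    aff_rel (e i.+1 * e i * e i.+1) (e i.+1)
| rel_tau_e_tau_odd i : (1 <= i <= k.-1)%N ->
    aff_rel (tau i.*2 * e i.*2.-1 * tau i.*2)
            (tau i.*2.+1 * e i.*2.+1 * tau i.*2.+1)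
| rel_tau_e_tau_even i : (2 <= i <= k.-1)%N ->
    aff_rel (tau i.*2 * e i.*2.-2 * tau i.*2)
            (tau i.*2.-1 * e i.*2 * tau i.*2.-1)

| rel_xC i j : x_dom i -> x_dom j -> aff_rel (x i * x j) (x j * x i)
| rel_tauC_x i j : tau_dom i -> x_dom j ->
    j.+1 != i -> j != i -> j != i.+1 ->
    aff_rel (tau i * x j) (x j * tau i)
| rel_eC_x i j : e_dom i -> x_dom j -> j != i -> j != i.+1 ->
    aff_rel (e i * x j) (x j * e i)

| rel_tau_braid_even i : tau_dom i.*2.-2 -> tau_dom i.*2 -> e_dom i.*2.-2 ->
    aff_rel (tau i.*2.-2 * tau i.*2 * tau i.*2.-2)
            (tau i.*2 * tau i.*2.-2 * tau i.*2 * (1 - e i.*2.-2))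
| rel_tau_braid_odd i : tau_dom i.*2.+1 -> tau_dom i.*2.-1 -> e_dom i.*2 ->
    aff_rel (tau i.*2.+1 * tau i.*2.-1 * tau i.*2.+1)
            (tau i.*2.-1 * tau i.*2.+1 * tau i.*2.-1 * (1 - e i.*2))
| rel_tau_odd_even_odd i : tau_dom i.*2.-1 -> tau_dom i.*2 -> e_dom i.*2.-2 ->
    aff_rel (tau i.*2.-1 * tau i.*2 * tau i.*2.-1)
            (tau i.*2 - e i.*2.-2 * tau i.*2 - tau i.*2 * e i.*2.-2)
| rel_tau_even_odd_even i : tau_dom i.*2 -> tau_dom i.*2.-1 -> e_dom i.*2 ->
    aff_rel (tau i.*2 * tau i.*2.-1 * tau i.*2)
            (tau i.*2.-1 - e i.*2 * tau i.*2.-1 - tau i.*2.-1 * e i.*2)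

| rel_x_odd_next i : (1 <= i <= k.-1)%N ->
    aff_rel (x i.*2.+1)
            (tau i.*2 * x i.*2.-1 * tau i.*2
             + e i.*2 * e i.*2.-1 * tau i.*2
             + tau i.*2 * e i.*2.-1 * e i.*2 - tau i.*2)
| rel_x_even_next i : (1 <= i <= k.-1)%N ->
    aff_rel (x i.*2.+2)
            (tau i.*2.+1 * x i.*2 * tau i.*2.+1
             + e i.*2 * e i.*2.+1 * tau i.*2.+1 * e i.*2.+1 * e i.*2
             + tau i.*2.+1)
| rel_x_even i : (1 <= i <= k.-1)%N ->
    aff_rel (x i.*2)
            (tau i.*2 * x i.*2 * tau i.*2
             + e i.*2 * e i.*2.-1 * tau i.*2
             + tau i.*2 * e i.*2.-1 * e i.*2)
| rel_x_odd i : (1 <= i <= k.-1)%N ->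
    aff_rel (x i.*2.+1)
            (tau i.*2.+1 * x i.*2.+1 * tau i.*2.+1
             + e i.*2 * e i.*2.+1 * tau i.*2.+1
             + tau i.*2.+1 * e i.*2.+1 * e i.*2)

| rel_e_x i : (1 <= i <= k.*2.-1)%N ->
    aff_rel (e i * (x i - x i.+1)) 0
| rel_x_e i : (1 <= i <= k.*2.-1)%N ->
    aff_rel ((x i - x i.+1) * e i) 0

| rel_e_x_e l : (1 <= l)%N ->
    aff_rel (e 1 * x 1 ^+ l * e 1) (z l * e 1)
| rel_z_central l a : aff_rel (z l * a) (a * z l).

End Relations.

Section Presentation.
Variables (K : comNzRingType) (k : nat).

Definition gen : choiceType :=
  ({i : nat | tau_dom k i} + {j : nat | e_dom k j} + {r : nat | x_dom k r} + nat)%type.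

Local Notation free_alg := {malg K[{fmonom gen}]}.

Definition free_gen (g : gen) : free_alg := << fmu g >>.

(* Generators are indexed by nat, with the junk value 0 outside their domain;
   the relations only involve generators within their domain. *)
Definition ftau (i : nat) : free_alg :=
  oapp (fun u => free_gen (inl (inl (inl u)))) 0 (insub i).
Definition fe (j : nat) : free_alg :=
  oapp (fun u => free_gen (inl (inl (inr u)))) 0 (insub j).
Definition fx (r : nat) : free_alg :=
  oapp (fun u => free_gen (inl (inr u))) 0 (insub r).
Definition fz (l : nat) : free_alg := free_gen (inr l).

Definition aff_ideal : set free_alg :=
  ideal_generated [set w | exists u v, aff_rel k ftau fe fx fz u v /\ w = u - v].

Lemma aff_ideal_two_sided : two_sided_ideal aff_ideal.
Proof.
split; last by move=> a u b Iu I [HI GI]; apply: HI.2; apply: (Iu I).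
split=> [|u v]; rewrite ?inE.
  by move=> I [[[I0 _] _] _]; move: I0; rewrite !inE.
move=> Iu Iv I HI; have [[[_ IB] _] _] := HI.
by have := IB u v; rewrite !inE; apply; [apply: Iu | apply: Iv].
Qed.

Definition aff_ideal_pred : {pred free_alg} := fun u => u \in aff_ideal.

Lemma aff_ideal_pred_zmod : zmod_closed aff_ideal_pred.
Proof. exact: (aff_ideal_two_sided).1. Qed.

HB.instance Definition _ :=
  GRing.isZmodClosed.Build free_alg aff_ideal_pred aff_ideal_pred_zmod.

Definition aff_alg := Quotient.quot aff_ideal_pred.

HB.instance Definition _ := Choice.on aff_alg.
HB.instance Definition _ := EqQuotient.on aff_alg.
HB.instance Definition _ := GRing.Zmodule.on aff_alg.

Definition aff_pi (u : free_alg) : aff_alg := \pi_aff_alg u.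

Lemma aff_piP (u v : free_alg) : aff_pi u = aff_pi v <-> aff_ideal (u - v).
Proof.
rewrite (rwP eqP) /aff_pi -Quotient.idealrBE -[_ - _ \in _]/(_ \in aff_ideal).
by rewrite inE.
Qed.

Lemma aff_piK (a : aff_alg) : aff_pi (repr a) = a.
Proof. exact: reprK. Qed.

Lemma aff_piB (u v : free_alg) : aff_pi (u - v) = aff_pi u - aff_pi v.
Proof. exact: (raddfB (\pi_aff_alg)). Qed.

Lemma aff_pi0 : aff_pi 0 = 0.
Proof. exact: (raddf0 (\pi_aff_alg)). Qed.

Lemma aff_piD (u v : free_alg) : aff_pi (u + v) = aff_pi u + aff_pi v.
Proof. exact: (raddfD (\pi_aff_alg)). Qed.

(* The nontriviality of the quotient is needed for its structure of algebra. It
   is witnessed by the character that sends every tau_i to 1, every e_j and z_l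
   to 0, x_(2 i - 1) to - i and x_(2 i) to i. *)
Definition chi_gen (g : gen) : K :=
  match g with
  | inl (inl (inl _)) => 1
  | inl (inl (inr _)) => 0
  | inl (inr r) => if odd (val r) then - (uphalf (val r))%:R else (val r)./2%:R
  | inr _ => 0
  end.

Definition chi_mon (m : {fmonom gen}) : K := \prod_(g <- m) chi_gen g.

Lemma chi_mon_mmorphism : mmorphism chi_mon.
Proof.
split=> [m1 m2|]; rewrite /chi_mon.
  by rewrite fmM big_cat.
by rewrite fm1 big_nil.
Qed.

HB.instance Definition _ := isMultiplicative.Build _ _ chi_mon chi_mon_mmorphism.

Lemma chi_exists :
  {chi : {rmorphism free_alg -> K} | forall g, chi (free_gen g) = chi_gen g}.
Proof.
exists (mmap idfun chi_mon) => g.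
by rewrite /free_gen /= mmapU /= mul1r /chi_mon fmU big_seq1.
Qed.

Lemma character_rel (A : nzRingType) (tau e x z : nat -> A)
    (chi : {rmorphism A -> K}) :
  (forall i, tau_dom k i -> chi (tau i) = 1) ->
  (forall j, chi (e j) = 0) ->
  (forall r, x_dom k r ->
     chi (x r) = if odd r then - (uphalf r)%:R else r./2%:R) ->
  (forall l, chi (z l) = 0) ->
  forall u v, aff_rel k tau e x z u v -> chi u = chi v.
Proof.
move=> tauE eE xE zE u v.
have tau_even i : (1 <= i <= k.-1)%N -> chi (tau i.*2) = 1.
  by move=> ?; apply: tauE; rewrite /tau_dom; lia.
have tau_odd i : (1 <= i <= k.-1)%N -> chi (tau i.*2.+1) = 1.
  by move=> ?; apply: tauE; rewrite /tau_dom; lia.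
pose m := (rmorphB chi, rmorphD chi, rmorphM chi, rmorphXn chi, rmorph1 chi,
  rmorph0 chi).
pose s := (mulr0, mul0r, mulr1, mul1r, addr0, add0r, subr0).
case=> {u v}; rewrite /sgen => i.
all: try by move=> di; rewrite !m ?eE ?zE ?tau_even ?tau_odd // ?s
  ?expr1n ?expr0n.
all: try by move=> *; rewrite !m ?eE ?tauE // ?s.
all: try by move=> j *; rewrite !m mulrC.
- move=> di; have [di' diS] : (1 <= i <= k.-1)%N /\ (1 <= i.+1 <= k.-1)%N.
    by split; lia.
  by rewrite !m !eE !tau_even ?tau_odd.
- by move=> di; rewrite !m !eE !s.
- move=> di; rewrite !m !eE tau_even // !s !xE; try (rewrite /x_dom; lia).
  have -> : odd i.*2.-1 by lia.
  have -> : uphalf i.*2.-1 = i by lia.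
  by rewrite /= odd_double doubleK -addn1 natrD opprD.
- move=> di; rewrite !m !eE tau_odd // !s !xE; try (rewrite /x_dom; lia).
  by rewrite /= negbK odd_double doubleK -addn1 natrD.
Qed.

Lemma aff_ideal1 : ~ aff_ideal 1.
Proof.
have [chi chi_genE] := chi_exists.
have chi_rel u v : aff_rel k ftau fe fx fz u v -> chi u = chi v.
  apply: character_rel => i.
  - by move=> di; rewrite /ftau insubT /= chi_genE.
  - rewrite /fe; case: insubP => [w _ _|_] /=; rewrite ?chi_genE //.
    exact: (rmorph0 chi).
  - by move=> di; rewrite /fx insubT /= chi_genE.
  - by rewrite /fz chi_genE.
suff chi_ideal u : aff_ideal u -> chi u = 0.
  by move/chi_ideal/eqP; rewrite rmorph1 oner_eq0.
move/(_ [set w | chi w = 0]); apply; split=> /=; last first.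
  by move=> _ [x [y [/chi_rel xy ->]]]; rewrite /= rmorphB xy subrr.
split=> [|a w b /= w0]; last by rewrite !rmorphM /= w0 mulr0 mul0r.
split=> [|a b]; rewrite !inE /= ?rmorph0 // => a0 b0.
by rewrite rmorphB a0 b0 subrr.
Qed.

Definition aff_one : aff_alg := aff_pi 1.
Definition aff_mul (a b : aff_alg) : aff_alg := aff_pi (repr a * repr b).
Definition aff_scale (c : K) (a : aff_alg) : aff_alg := aff_pi (c *: repr a).

Lemma aff_pi_reprB (u : free_alg) : aff_ideal (u - repr (aff_pi u)).
Proof. by apply/aff_piP; rewrite aff_piK. Qed.

Lemma aff_piM (u v : free_alg) : aff_pi (u * v) = aff_mul (aff_pi u) (aff_pi v).
Proof.
have [[_ IB] IM] := aff_ideal_two_sided.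
apply/aff_piP; set u' := repr _; set v' := repr _.
have -> : u * v - u' * v' = 1 * (u - u') * v - u' * (v' - v) * 1.
  by rewrite mul1r mulr1 mulrBl mulrBr opprB addrA subrK.
have := IB (1 * (u - u') * v) (u' * (v' - v) * 1); rewrite !inE; apply.
  by apply: IM; apply: aff_pi_reprB.
by apply: IM; apply/aff_piP; rewrite aff_piK.
Qed.

Lemma aff_piZ c (u : free_alg) : aff_pi (c *: u) = aff_scale c (aff_pi u).
Proof.
have [_ IM] := aff_ideal_two_sided.
apply/aff_piP; rewrite -scalerBr -mul_malgC -[_ * _]mulr1.
by apply: IM; apply: aff_pi_reprB.
Qed.

Lemma aff_mulA : associative aff_mul.
Proof.
by move=> a b c; rewrite -[a]aff_piK -[b]aff_piK -[c]aff_piK -!aff_piM mulrA.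
Qed.

Lemma aff_mul1l : left_id aff_one aff_mul.
Proof. by move=> a; rewrite -[a]aff_piK -aff_piM mul1r. Qed.

Lemma aff_mul1r : right_id aff_one aff_mul.
Proof. by move=> a; rewrite -[a]aff_piK -aff_piM mulr1. Qed.

Lemma aff_mulDl : left_distributive aff_mul +%R.
Proof.
move=> a b c; rewrite -[a]aff_piK -[b]aff_piK -[c]aff_piK.
by rewrite -aff_piD -!aff_piM mulrDl aff_piD.
Qed.

Lemma aff_mulDr : right_distributive aff_mul +%R.
Proof.
move=> a b c; rewrite -[a]aff_piK -[b]aff_piK -[c]aff_piK.
by rewrite -aff_piD -!aff_piM mulrDr aff_piD.
Qed.

Lemma aff_one_neq0 : aff_one != 0.
Proof.
by apply/eqP; rewrite -aff_pi0 => /aff_piP; rewrite subr0 => /aff_ideal1.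
Qed.

HB.instance Definition _ := GRing.Zmodule_isNzRing.Build aff_alg
  aff_mulA aff_mul1l aff_mul1r aff_mulDl aff_mulDr aff_one_neq0.

Lemma aff_scaleA c d a : aff_scale c (aff_scale d a) = aff_scale (c * d) a.
Proof. by rewrite -[a]aff_piK -!aff_piZ scalerA. Qed.

Lemma aff_scale1 : left_id 1 aff_scale.
Proof. by move=> a; rewrite -[a]aff_piK -aff_piZ scale1r. Qed.

Lemma aff_scaleDr : right_distributive aff_scale +%R.
Proof.
move=> c a b; rewrite -[a]aff_piK -[b]aff_piK.
by rewrite -aff_piD -!aff_piZ scalerDr aff_piD.
Qed.

Lemma aff_scaleDl a : {morph aff_scale^~ a : c d / c + d}.
Proof. by move=> c d; rewrite -[a]aff_piK -!aff_piZ scalerDl aff_piD. Qed.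

HB.instance Definition _ := GRing.Zmodule_isLmodule.Build K aff_alg
  aff_scaleA aff_scale1 aff_scaleDr aff_scaleDl.

Lemma aff_scaleAl (c : K) (a b : aff_alg) : c *: (a * b) = (c *: a) * b.
Proof.
rewrite -[a]aff_piK -[b]aff_piK.
by rewrite /GRing.scale /GRing.mul /= -!(aff_piZ, aff_piM) scalerAl.
Qed.

HB.instance Definition _ := GRing.Lmodule_isLalgebra.Build K aff_alg aff_scaleAl.

Lemma free_malgC_comm (c : K) (u : free_alg) : c%:MP * u = u * c%:MP.
Proof.
rewrite !malgM_def fgmulUg fgmulgU; apply: eq_bigr => m _.
by rewrite mulrC mul1m mulm1.
Qed.

Lemma aff_scaleAr (c : K) (a b : aff_alg) : c *: (a * b) = a * (c *: b).
Proof.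
rewrite -[a]aff_piK -[b]aff_piK.
rewrite /GRing.scale /GRing.mul /= -!(aff_piZ, aff_piM); congr aff_pi.
by rewrite -!mul_malgC !mulrA free_malgC_comm.
Qed.

HB.instance Definition _ := GRing.Lalgebra_isAlgebra.Build K aff_alg aff_scaleAr.

Definition aff_tau (i : nat) : aff_alg := aff_pi (ftau i).
Definition aff_e (j : nat) : aff_alg := aff_pi (fe j).
Definition aff_x (r : nat) : aff_alg := aff_pi (fx r).
Definition aff_z (l : nat) : aff_alg := aff_pi (fz l).

Definition super_power_sum (n : nat) : aff_alg :=
  \sum_(1 <= i < k.+1) aff_x i.*2.-1 ^+ n - \sum_(1 <= i < k.+1) aff_x i.*2 ^+ n.

Definition SSym : set aff_alg :=
  subalg_generated [set p | exists2 n, (1 <= n)%N & p = super_power_sum n].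

End Presentation.

Arguments aff_alg : clear implicits.
Arguments aff_tau : clear implicits.
Arguments aff_e : clear implicits.
Arguments aff_x : clear implicits.
Arguments aff_z : clear implicits.
Arguments super_power_sum : clear implicits.
Arguments SSym : clear implicits.
Arguments alg_center : clear implicits.

(* Main.v *)
(* Only the two or three generators x_j that do not commute with a given
   generator matter. For e_i this is the pair x_i, x_(i+1), whose powers enter
   p_n with opposite signs and agree when multiplied by e_i. For tau_i they are
   a = x_(i-1), b = x_i, c = x_(i+1), entering p_n through +-(a^n - b^n + c^n).
   With t = tau_i for i even, t = - tau_i for i odd, f = e_(i-1) and e = e_i, the
   defining relations give
     t c = a t + (f e - 1),   c t = t a + (e f - 1),   t b = b t + (f e - e f),
   and expanding n-th powers the error terms cancel, because a and b agree next
   to f while b and c agree next to e. *)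
Require Import Defs.
From HB Require Import structures.
From mathcomp Require Import all_boot all_order all_algebra.
From mathcomp Require Import boolp classical_sets reals complex.
From mathcomp Require Import zify.
From mathcomp.multinomials Require Import monalg.

Set Implicit Arguments.
Unset Strict Implicit.
Unset Printing Implicit Defensive.

Import GRing.Theory.
Local Open Scope ring_scope.
Local Open Scope classical_set_scope.

(** * Ring identities for powers and alternating sums *)

Section RingLemmas.
Variable A : nzRingType.
Implicit Types (t a b c e f w : A) (F : nat -> A).

(** [t] moves past the factors [c] one at a time; each passage turns a [c] into an [a] and leaves
    one [w] at that place. *)
Lemma expr_intertwine t a c w n : t * c = a * t + w ->
  t * c ^+ n = a ^+ n * t + \sum_(i < n) a ^+ i * w * c ^+ (n - i.+1).
Proof.
move=> tc; elim: n => [|n IHn]; first by rewrite !expr0 mulr1 mul1r big_ord0 addr0.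
rewrite exprSr mulrA IHn mulrDl -mulrA tc mulrDr mulrA -exprSr -addrA.
congr (_ + _); rewrite big_ord_recr /= subnn expr0 mulr1 addrC; congr (_ + _).
rewrite mulr_suml; apply: eq_bigr => i _.
by rewrite -mulrA -exprSr; congr (_ * _ ^+ _); have := ltn_ord i; lia.
Qed.

(** Commutation brings the remaining factor [a] next to [f], where it can be exchanged for [b]. *)
Lemma expr_mul_eq a b f n : a * f = b * f -> GRing.comm a b ->
  a ^+ n * f = b ^+ n * f.
Proof.
move=> abf ab; elim: n => [|n IHn]; first by rewrite !expr0.
by rewrite exprS -mulrA IHn mulrA (commrX n ab) -mulrA abf mulrA -exprSr.
Qed.

Lemma mul_expr_eq a b f n : f * a = f * b -> GRing.comm a b ->
  f * a ^+ n = f * b ^+ n.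
Proof.
move=> abf ab; elim: n => [|n IHn]; first by rewrite !expr0.
by rewrite exprSr mulrA IHn -mulrA -(commrX n ab) mulrA abf -mulrA -exprS.
Qed.

Lemma comm_super_window t a b c e f n :
  t * c = a * t + (f * e - 1) -> c * t = t * a + (e * f - 1) ->
  t * b = b * t + (f * e - e * f) ->
  GRing.comm a b -> GRing.comm a c -> GRing.comm b c ->
  a * f = b * f -> f * a = f * b -> c * e = b * e -> e * c = e * b ->
  GRing.comm t (a ^+ n - b ^+ n + c ^+ n).
Proof.
move=> tc ct tb ab ac bc af fa ce ec.
(* Solved for [t * a], the second relation gets the shape that [expr_intertwine] expects. *)
have ta : t * a = c * t + (1 - e * f) by rewrite ct -addrA -opprB addNr addr0.
rewrite /GRing.comm mulrDr mulrBr (expr_intertwine _ tc).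
rewrite (expr_intertwine _ ta) (expr_intertwine _ tb).
set Sa := \sum_(i < n) _; set Sb := \sum_(i < n) _; set Sc := \sum_(i < n) _.
(* The total error is [Sa - Sb + Sc], since [t] exchanges the powers of [a] and [c] and fixes those
   of [b]. *)
suff SE : Sb = Sa + Sc.
  rewrite SE mulrDl mulrBl opprD [X in X + _]addrACA [LHS]addrACA.
  by rewrite [Sa - _ + Sc]addrAC subrr addr0 addrC [RHS]addrAC addrA.
(* Powers of [a] next to [f] and of [c] next to [e] become powers of [b]. The claim is then
   [Tf - Te = (T1 - Te) + (Tf - T1)]. *)
pose Tf := \sum_(i < n) b ^+ i * (f * e) * b ^+ (n - i.+1).
pose Te := \sum_(i < n) b ^+ i * (e * f) * b ^+ (n - i.+1).
pose T1 := \sum_(i < n) a ^+ i * c ^+ (n - i.+1).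
have SbE : Sb = Tf - Te.
  by rewrite /Sb -sumrB; apply: eq_bigr => i _; rewrite mulrBr mulrBl.
have ScE : Sc = Tf - T1.
  rewrite /Sc -sumrB; apply: eq_bigr => i _; rewrite mulrBr mulrBl mulr1.
  by rewrite !mulrA (expr_mul_eq _ af ab) -!mulrA
    (mul_expr_eq _ ec (commr_sym bc)).
have SaE : Sa = T1 - Te.
  (* Reversing the summation order shows that [T1] is symmetric in the commuting [a] and [c]. *)
  have -> : T1 = \sum_(i < n) c ^+ i * a ^+ (n - i.+1).
    rewrite /T1 (reindex_inj rev_ord_inj); apply: eq_bigr => i _ /=.
    rewrite (_ : n - (n - i.+1).+1 = i)%N; last by have := ltn_ord i; lia.
    exact/commrX/commr_sym/commrX/commr_sym.
  rewrite /Sa -sumrB; apply: eq_bigr => i _; rewrite mulrBr mulrBl mulr1.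
  by rewrite !mulrA (expr_mul_eq _ ce (commr_sym bc)) -!mulrA
    (mul_expr_eq _ fa ab).
by rewrite SbE SaE ScE [RHS]addrC addrA subrK.
Qed.

(* Here e is e_(2j) and f is e_(2j-1) or e_(2j+1): for t = tau_(2j+1) the roles of
   e and f are exchanged with respect to comm_super_window, hence the sign there. *)
Section Step.
Variables t e f : A.
Hypotheses (tt : t * t = 1 - e) (ee : e * e = e) (te : t * e = 0) (et : e * t = 0).
Hypothesis efe : e * f * e = e.

(** Each [t * t] becomes [1 - e]. The resulting [e * a * t] vanishes because [e] passes [a] and
    meets [t], and [efe] cancels the stray [e]. *)
Lemma step_odd_next a c : e * a = a * e ->
  c = t * a * t + e * f * t + t * f * e - t ->
  t * c = a * t + (f * e - 1) /\ c * t = t * a + (e * f - 1).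
Proof.
move=> ea ->; split.
  rewrite mulrBr !mulrDr !mulrA tt te !mul0r addr0 !mulrBl !mul1r ea.
  by rewrite efe -(mulrA a) et mulr0 subr0 opprB !addrA subrK.
rewrite mulrBl !mulrDl -!mulrA tt et !mulr0 addr0 !mulrBr !mulr1 -ea.
by rewrite (mulrA e) efe (mulrA t) te mul0r subr0 opprB !addrA subrK.
Qed.

(** Multiplying by [e] kills the summands that have [t] on that side. The last two identities also
    feed [step_even_next]. *)
Lemma step_fixed b : b = t * b * t + e * f * t + t * f * e ->
  [/\ t * b = b * t + (f * e - e * f), e * b = e * f * t & b * e = t * f * e].
Proof.
move=> bE.
have eb : e * b = e * f * t.
  by rewrite bE !mulrDr !mulrA et ee !mul0r add0r addr0.
have be : b * e = t * f * e.
  by rewrite bE !mulrDl -!mulrA te ee !mulr0 !add0r.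
split=> //; rewrite {1}bE !mulrDr !mulrA tt te !mul0r addr0 !mulrBl !mul1r.
rewrite eb efe -!mulrA tt !mulrBr mulr1 mulrA efe.
by rewrite opprB -addrA; congr (_ + _); rewrite addrC addrA subrK.
Qed.

(** Here [e] need not commute with [b]; the formulas for [e * b] and [b * e] take the place of that
    commutation. *)
Lemma step_even_next b d : e * b = e * f * t -> b * e = t * f * e ->
  d = t * b * t + e * f * t * f * e + t ->
  t * d = b * t + (1 - e * f) /\ d * t = t * b + (1 - f * e).
Proof.
move=> eb be ->; split.
  rewrite !mulrDr !mulrA tt te !mul0r addr0 mulrBl mul1r mulrBl eb.
  rewrite -(mulrA (e * f)) tt mulrBr mulr1 efe.
  by rewrite opprB -addrA; congr (_ + _); rewrite addrC addrA subrK.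
rewrite !mulrDl -!mulrA tt et !mulr0 addr0 !mulrBr !mulr1 be.
rewrite !mulrA tt !mulrBl mul1r efe.
by rewrite opprB -addrA; congr (_ + _); rewrite addrC addrA subrK.
Qed.

End Step.

(** A single sum over consecutive indices lets the window of non-commuting terms be cut out as an
    interval. *)
Lemma alternating_sumE F m :
  \sum_(1 <= i < m.+1) F i.*2.-1 - \sum_(1 <= i < m.+1) F i.*2 =
  \sum_(1 <= r < m.*2.+1) (-1) ^+ r.+1 * F r.
Proof.
elim: m => [|m IHm]; first by rewrite !big_nil subr0.
rewrite doubleS !(big_nat_recr m.+1) ?(big_nat_recr m.*2.+2) ?(big_nat_recr m.*2.+1) //=.
rewrite -IHm !exprS -[(-1) ^+ _]signr_odd odd_double !mulN1r !opprK mul1r mulN1r.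
by rewrite opprD addrACA addrA.
Qed.

Lemma comm_sum_window F t m n p q : (m <= n <= p)%N -> (p <= q)%N ->
  (forall r, (m <= r < q)%N -> ~~ (n <= r < p)%N -> GRing.comm t (F r)) ->
  GRing.comm t (\sum_(n <= r < p) F r) ->
  GRing.comm t (\sum_(m <= r < q) F r).
Proof.
move=> /andP[mn np] pq tF tw.
rewrite (big_cat_nat (leq_trans mn np) pq) (big_cat_nat mn np) /=.
apply: commrD; first apply: commrD => //.
  by rewrite big_nat; apply: commr_sum => r ?; apply: tF; lia.
by rewrite big_nat; apply: commr_sum => r ?; apply: tF; lia.
Qed.

End RingLemmas.

(** * Commutation of the power sums with the images of [e] and [tau] *)

Section AbstractRelations.
Variables (k : nat) (F A : nzRingType) (phi : {rmorphism F -> A}).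
Variables (tau e x z : nat -> F).
Hypothesis phi_rel : forall u v, aff_rel k tau e x z u v -> phi u = phi v.

Let T i := phi (tau i).
Let E i := phi (e i).
Let X i := phi (x i).

(** These rules push [phi] down to the generators; the [erefl] entries fold their images into [T],
    [E] and [X]. *)
Let phiE := (rmorphB phi, rmorphD phi, rmorphM phi, rmorphXn phi,
  rmorph1 phi, rmorph0 phi, (fun i => erefl : phi (tau i) = T i),
  (fun i => erefl : phi (e i) = E i), (fun i => erefl : phi (x i) = X i)).

Let p n := \sum_(1 <= r < k.*2.+1) (-1) ^+ r.+1 * X r ^+ n.

Lemma comm_X i j : x_dom k i -> x_dom k j -> GRing.comm (X i) (X j).
Proof. by move=> di dj; have := phi_rel (rel_xC tau e x z di dj); rewrite !phiE. Qed.

Lemma E_X_eq i : e_dom k i ->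
  E i * X i = E i * X i.+1 /\ X i * E i = X i.+1 * E i.
Proof.
move=> di; have di' : (1 <= i <= k.*2.-1)%N := di.
have /eqP := phi_rel (rel_e_x tau e x z di').
have /eqP := phi_rel (rel_x_e tau e x z di').
by rewrite !phiE mulrBl mulrBr !subr_eq0 => /eqP ? /eqP.
Qed.

Lemma comm_E_p i n : e_dom k i -> GRing.comm (E i) (p n).
Proof.
move=> di; have [EX XE] := E_X_eq di; have := di; rewrite /e_dom => di'.
have XC : GRing.comm (X i) (X i.+1) by apply: comm_X; rewrite /x_dom; lia.
apply: (@comm_sum_window _ _ _ 1 i i.+2) => [||r dr ri|]; try lia.
  apply: commrM; first exact: commr_sign.
  apply: commrX; have [d1 d2 d3] : [/\ x_dom k r, r != i & r != i.+1].
    by rewrite /x_dom; split; lia.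
  by have := phi_rel (rel_eC_x tau e x z di d1 d2 d3); rewrite !phiE.
(* The two window terms have opposite signs, and [E i] kills the difference of the powers on both
   sides. *)
rewrite big_ltn ?big_nat1 // [(-1) ^+ i.+2]exprS mulN1r mulNr -mulrBr.
apply: commrM; first exact: commr_sign.
rewrite /GRing.comm mulrBr mulrBl (mul_expr_eq _ EX XC).
by rewrite (expr_mul_eq _ XE XC) !subrr.
Qed.

(** Indexing the generator by [i.+1] avoids a predecessor at the left end of the window. *)
Lemma comm_T_p i n : tau_dom k i.+1 ->
  GRing.comm (T i.+1) (X i ^+ n - X i.+1 ^+ n + X i.+2 ^+ n) ->
  GRing.comm (T i.+1) (p n).
Proof.
rewrite /tau_dom => di window.
apply: (@comm_sum_window _ _ _ 1 i i.+3) => [||r dr ri|]; try lia.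
  apply: commrM; first exact: commr_sign.
  apply: commrX; have dr' : x_dom k r by rewrite /x_dom; lia.
  have [d1 d2 d3] : [/\ r.+1 != i.+1, r != i.+1 & r != i.+2] by split; lia.
  by have := phi_rel (rel_tauC_x tau e x z di dr' d1 d2 d3); rewrite !phiE.
rewrite 2?big_ltn ?big_nat1; try lia.
rewrite [(-1) ^+ i.+3]exprS [(-1) ^+ i.+2]exprS !mulN1r opprK mulNr addrA.
by rewrite -mulrBr -mulrDr; apply: commrM => //; apply: commr_sign.
Qed.

Lemma comm_T_even_p i n : (1 <= i <= k.-1)%N -> GRing.comm (T i.*2) (p n).
Proof.
(* After this shift [a], [b], [c] are [X] at [i.*2.+1], [i.*2.+2], [i.*2.+3], while [f] and [e] are
   [E] at the first two of these indices. *)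
case: i => // i di; rewrite doubleS.
apply: comm_T_p; first by rewrite /tau_dom; lia.
have := phi_rel (rel_tau_even_sq tau e x z di).
have := phi_rel (rel_e_even_sq tau e x z di).
have := phi_rel (rel_tau_even_e tau e x z di).
have := phi_rel (rel_e_tau_even tau e x z di).
have := phi_rel (rel_x_odd_next tau e x z di).
have := phi_rel (rel_x_even tau e x z di).
have di' : (1 <= i.*2.+1 <= k.*2.-2)%N by lia.
have := phi_rel (rel_eS_e_eS tau e x z di').
rewrite doubleS !phiE !expr2 /= => efe bE cE et te ee tt.
have [d1 d2 d3 d4] : [/\ e_dom k i.*2.+2, x_dom k i.*2.+1,
  i.*2.+1 != i.*2.+2 & i.*2.+1 != i.*2.+3] by rewrite /e_dom /x_dom; split; lia.
have := phi_rel (rel_eC_x tau e x z d1 d2 d3 d4); rewrite !phiE => ea.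
have [tc ct] := step_odd_next tt te et efe ea cE.
have [tb _ _] := step_fixed tt ee te et efe bE.
have [ec ce] := E_X_eq d1.
have [fa af] : E i.*2.+1 * X i.*2.+1 = E i.*2.+1 * X i.*2.+2 /\
               X i.*2.+1 * E i.*2.+1 = X i.*2.+2 * E i.*2.+1.
  by apply: E_X_eq; rewrite /e_dom; lia.
apply: (comm_super_window _ tc ct tb) => //.
all: by apply: comm_X; rewrite /x_dom; lia.
Qed.

Lemma comm_T_odd_p i n : (1 <= i <= k.-1)%N -> GRing.comm (T i.*2.+1) (p n).
Proof.
move=> di; apply: comm_T_p; first by rewrite /tau_dom; lia.
have := phi_rel (rel_tau_odd_sq tau e x z di).
have := phi_rel (rel_e_even_sq tau e x z di).
have := phi_rel (rel_tau_odd_e tau e x z di).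
have := phi_rel (rel_e_tau_odd tau e x z di).
have := phi_rel (rel_x_even_next tau e x z di).
have := phi_rel (rel_x_odd tau e x z di).
have di' : (1 <= i.*2 <= k.*2.-2)%N by lia.
have := phi_rel (rel_e_eS_e tau e x z di').
rewrite !phiE !expr2 /= => efe cE dE et te ee tt.
have [eb be] : E i.*2 * X i.*2 = E i.*2 * X i.*2.+1 /\
               X i.*2 * E i.*2 = X i.*2.+1 * E i.*2.
  by apply: E_X_eq; rewrite /e_dom; lia.
have [gc cg] : E i.*2.+1 * X i.*2.+1 = E i.*2.+1 * X i.*2.+2 /\
               X i.*2.+1 * E i.*2.+1 = X i.*2.+2 * E i.*2.+1.
  by apply: E_X_eq; rewrite /e_dom; lia.
have [tc ec ce] := step_fixed tt ee te et efe cE.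
(* [X i.*2] and [X i.*2.+1] agree next to [E i.*2], so the identities that [step_fixed] gives for
   the latter transfer to the former. *)
have [td dt] := step_even_next tt te et efe (etrans eb ec) (etrans be ce) dE.
rewrite -[T _]opprK; apply/commr_sym/commrN/commr_sym.
apply: (@comm_super_window _ _ _ _ _ (E i.*2.+1) (E i.*2)) => //.
- by rewrite mulNr td opprD opprB mulrN.
- by rewrite mulrN dt opprD opprB mulNr.
- by rewrite mulNr tc opprD opprB mulrN.
all: by apply: comm_X; rewrite /x_dom; lia.
Qed.

End AbstractRelations.

(** * Centrality in the presented algebra and its passage to the subalgebra *)

Section Generators.
Variables (K : comNzRingType) (k : nat).
Local Notation tau := (aff_tau K k).
Local Notation e := (aff_e K k).
Local Notation x := (aff_x K k).
Local Notation z := (aff_z K k).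

Lemma aff_pi_mul u v : @aff_pi K k (u * v) = aff_pi u * aff_pi v.
Proof. exact: aff_piM. Qed.

Lemma aff_pi_scale c u : @aff_pi K k (c *: u) = c *: aff_pi u.
Proof. exact: aff_piZ. Qed.

Lemma aff_pi_rel u v :
  aff_rel k (ftau K k) (fe K k) (fx K k) (fz K k) u v -> aff_pi u = aff_pi v.
Proof.
by move=> uv; apply/aff_piP => I [_]; apply; exists u, v.
Qed.

(** A representative in the free algebra is a linear combination of words in the generators, so
    induction on the length of a word suffices. *)
Lemma comm_gens (b : aff_alg K k) :
  (forall i, tau_dom k i -> GRing.comm b (tau i)) ->
  (forall i, e_dom k i -> GRing.comm b (e i)) ->
  (forall r, x_dom k r -> GRing.comm b (x r)) ->
  (forall l, GRing.comm b (z l)) ->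
  forall a, GRing.comm b a.
Proof.
move=> btau be bx bz a; rewrite -[a]aff_piK; move: (repr a) => {a} u.
have bgen g : GRing.comm b (aff_pi (@free_gen K k g)).
  case: g => [[[[i di]|[i di]]|[r dr]]|l]; last exact: bz.
  - by have := btau i di; rewrite /aff_tau /ftau insubT.
  - by have := be i di; rewrite /aff_e /fe insubT.
  - by have := bx r dr; rewrite /aff_x /fx insubT.
rewrite (monalgE u) (big_morph _ (@aff_piD K k) (@aff_pi0 K k)).
apply: commr_sum => m _.
have -> : (<< u@_m *g m >> = u@_m *: << m >>)%M.
  by rewrite -mul_malgC malgM_def fgmulUU mulr1 mul1m.
rewrite aff_pi_scale.
suff bm : GRing.comm b (aff_pi (<< m >>)%M).
  by rewrite /GRing.comm -scalerAr -scalerAl bm.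
case: m => s; elim: s => [|g s IHs].
  rewrite (_ : FMonom [::] = mone); last by rewrite /mone /one /= fmoneE.
  by rewrite mpolyC1E; apply: commr1.
have -> : (<< FMonom (g :: s) >> = @free_gen K k g * << FMonom s >>)%M.
  rewrite malgM_def fgmulUU mulr1; congr (<< _ >>)%M.
  by rewrite /mmul /mul /= fmmulE fmuE.
rewrite aff_pi_mul; exact: (commrM (bgen g) IHs).
Qed.

Lemma comm_z l a : GRing.comm (z l) a.
Proof.
rewrite -[a]aff_piK /GRing.comm /aff_z.
have := aff_pi_rel (rel_z_central k (ftau K k) (fe K k) (fx K k) (fz K k) l (repr a)).
rewrite !aff_pi_mul => zC; exact: zC.
Qed.

Lemma aff_pi_monoid_morphism : monoid_morphism (@aff_pi K k).
Proof. split; [exact: erefl | exact: aff_pi_mul]. Qed.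

HB.instance Definition _ :=
  GRing.isZmodMorphism.Build _ (aff_alg K k) (@aff_pi K k) (@aff_piB K k).
HB.instance Definition _ := GRing.isMonoidMorphism.Build _ (aff_alg K k)
  (@aff_pi K k) aff_pi_monoid_morphism.

Lemma super_power_sum_central n : alg_center (aff_alg K k) (super_power_sum K k n).
Proof.
pose phi : {rmorphism _ -> aff_alg K k} := @aff_pi K k.
have phi_rel u v : aff_rel k (ftau K k) (fe K k) (fx K k) (fz K k) u v ->
  phi u = phi v := @aff_pi_rel u v.
rewrite /super_power_sum (alternating_sumE (fun r => x r ^+ n)).
apply: comm_gens => [i di|i di|r dr|l]; apply: commr_sym.
(* Halving [i] separates the even and odd [tau]; the range of [i] forces [j] between 1 and
   [k.-1]. *)
- have [j dj [->|->]] : exists2 j, (1 <= j <= k.-1)%N & i = j.*2 \/ i = j.*2.+1.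
    by move: di; rewrite /tau_dom; exists i./2; lia.
  + exact: (comm_T_even_p phi_rel).
  + exact: (comm_T_odd_p phi_rel).
- exact: (comm_E_p phi_rel).
- rewrite big_nat; apply: commr_sum => i di.
  apply: commrM; [exact: commr_sign | apply: commrX].
  by apply: (comm_X phi_rel) => //; rewrite /x_dom; lia.
- exact: comm_z.
Qed.

End Generators.

Lemma alg_center_subalg_closed (K : comNzRingType) (A : algType K) :
  GRing.subalg_closed (mem (alg_center A)).
Proof.
split=> [|c a b|a b]; rewrite ?inE /alg_center /=.
- by move=> b; apply/commr_sym/commr1.
- move=> ca cb d; rewrite /GRing.comm mulrDl mulrDr -scalerAl -scalerAr.
  by rewrite ca cb.
- by move=> ca cb d; rewrite /GRing.comm -mulrA cb mulrA ca mulrA.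
Qed.

Theorem proposition3p2p3 (R : realType) (k : nat) (hk : (1 <= k)%N) :
  SSym R[i] k `<=` alg_center (aff_alg R[i] k).
Proof.
apply: smallest_sub; first exact: alg_center_subalg_closed.
by move=> _ [n _ ->]; apply: super_power_sum_central.
Qed.
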